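(* For any non-constant $L_k^p$-map $f: \Sigma \to M$, its stabilizer $\mathrm{Stab}_f = \{g \in G : f\circ g = f\}$ is a compact subgroup of $G$.
   Context: $M$ is a compact $C^\infty$-manifold with a Riemannian metric. $\Sigma \simeq S^2 \simeq \mathbf{CP}^1$ with its standard complex structure and round metric. $G_0 \simeq PSL(2,\mathbf{C})$ acts on $\Sigma$ as the group of reparametrizations (Möbius transformations); $G_1$ (resp. $G_2$) is the subgroup of $G_0$ fixing one marked point $x_1$ (resp. each of two distinct marked points $x_1, x_2$) of $\Sigma$. $G$ denotes any one of the three groups $G_0, G_1, G_2$, with its Lie group topology. The Sobolev order $k$ and exponent $p$ are fixed with $k - \frac{2}{p} > 1$. An $L_k^p$-map is a map $\Sigma \to M$ of Sobolev class $L_k^p$ ($k$ derivatives in $L^p$). $G$ acts on the space of $L_k^p$-maps by $(g,f) \mapsto f \circ g$. *)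

(* Defs.v *)
From HB Require Import structures.
From mathcomp Require Import all_boot all_order all_algebra.
From mathcomp Require Import complex.
From mathcomp Require Import ring.
From mathcomp Require Import all_classical all_reals all_analysis.

Set Implicit Arguments.
Unset Strict Implicit.
Unset Printing Implicit Defensive.
Set Warnings "-redundant-canonical-projection".

Import Order.TTheory GRing.Theory Num.Theory.
Import numFieldNormedType.Exports.

Local Open Scope classical_set_scope.
Local Open Scope complex_scope.
Local Open Scope quotient_scope.
Local Open Scope ring_scope.

(* Being C^m is expressed through iterated directional derivatives in all
   directions; in finite dimension this is the usual notion.  Only the values
   of [f] on the open set [U] matter. *)
Fixpoint Cm_on (R : realType) (V W : normedModType R) (m : nat)
    (U : set V) (f : V -> W) : Prop :=
  {in U, continuous f} /\
  if m is m'.+1 then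
    forall v : V, {in U, forall x, derivable f x v} /\
                  Cm_on m' U (fun x => 'D_v f x)
  else True.

Definition smooth_on (R : realType) (V W : normedModType R)
    (U : set V) (f : V -> W) : Prop :=
  forall m : nat, Cm_on m U f.

(* [chart_inv i] is the inverse of the chart [chart i : dom i -> 'rV_n]; the
   values of [chart i] outside [dom i] and of [chart_inv i] outside the image
   are irrelevant. *)
Record smooth_atlas (R : realType) (n : nat) (M : topologicalType) := {
  chart_idx : Type;
  dom : chart_idx -> set M;
  chart : chart_idx -> M -> 'rV[R]_n;
  chart_inv : chart_idx -> 'rV[R]_n -> M;
  dom_open : forall i, open (dom i);
  dom_cover : forall x : M, exists i, dom i x;
  chart_open : forall i, open (chart i @` dom i);
  chartK : forall i, {in dom i, cancel (chart i) (chart_inv i)};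
  chart_continuous : forall i, {in dom i, continuous (chart i)};
  chart_inv_continuous :
    forall i, {in chart i @` dom i, continuous (chart_inv i)};
  transition_smooth : forall i j,
    smooth_on (chart i @` (dom i `&` dom j)) (chart j \o chart_inv i)
}.

(* [metric i x] is the Gram matrix of the metric at the point of coordinates
   [x] in the chart [i]; [metric_compat] says that these matrices define one
   tensor on [M].  Vectors are rows, so a differential ['d f x] acts by
   right multiplication by ['J f x]. *)
Record riemannian_metric (R : realType) (n : nat) (M : topologicalType)
    (A : smooth_atlas R n M) := {
  metric : chart_idx A -> 'rV[R]_n -> 'M[R]_n;
  metric_smooth : forall i, smooth_on (chart i @` dom i) (metric i);
  metric_sym : forall i x, (chart i @` dom i) x ->
    (metric i x)^T = metric i x;
  metric_pos : forall i x, (chart i @` dom i) x ->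
    forall v : 'rV[R]_n, v != 0 -> 0 < (v *m metric i x *m v^T) 0 0;
  metric_compat : forall i j x, (chart i @` (dom i `&` dom j)) x ->
    let tau := chart j \o chart_inv i in
    metric i x = 'J tau x *m metric j (tau x) *m ('J tau x)^T
}.

HB.instance Definition _ (R : realType) := NormedModule.copy R[i] R[i]^o.

Definition sphere (R : realType) : Type := one_point_compactification R[i].

HB.instance Definition _ (R : realType) :=
  Topological.copy (sphere R) (one_point_compactification R[i]).

(* [None] is the point at infinity. *)
Definition mobius (R : realType) (A : 'M[R[i]]_2) (x : sphere R) : sphere R :=
  match x with
  | Some z => let den := A 1 0 * z + A 1 1 in
              if den == 0 then None else Some ((A 0 0 * z + A 0 1) / den)
  | None => if A 1 0 == 0 then None else Some (A 0 0 / A 1 0)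
  end.

Definition SL2 (R : realType) : Type := {A : 'M[R[i]]_2 | \det A == 1}.

HB.instance Definition _ (R : realType) := SubChoice.on (SL2 R).

HB.instance Definition _ (R : realType) :=
  Topological.copy (SL2 R) (initial_topology (val : SL2 R -> 'M[R[i]]_2)).

Lemma SL2_1_subproof (R : realType) : \det (1%:M : 'M[R[i]]_2) == 1.
Proof. by rewrite det1. Qed.

Lemma SL2_inv_subproof (R : realType) (A : SL2 R) : \det (\adj (val A)) == 1.
Proof.
have d1 : \det (val A) = 1 by apply/eqP; exact: (valP A).
have := congr1 (fun B => \det B) (mul_mx_adj (val A)).
by rewrite det_mulmx d1 mul1r det1 => ->.
Qed.

Lemma SL2_mul_subproof (R : realType) (A B : SL2 R) :
  \det (val A *m val B) == 1.
Proof.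
by rewrite det_mulmx (eqP (valP A)) (eqP (valP B)) mul1r.
Qed.

Definition SL2_one (R : realType) : SL2 R := Sub 1%:M (SL2_1_subproof R).
Definition SL2_inv (R : realType) (A : SL2 R) : SL2 R :=
  Sub (\adj (val A)) (SL2_inv_subproof A).
Definition SL2_mul (R : realType) (A B : SL2 R) : SL2 R :=
  Sub (val A *m val B) (SL2_mul_subproof A B).

Lemma SL2_mulA (R : realType) : associative (@SL2_mul R).
Proof. by move=> A B C; apply/val_inj; rewrite /= mulmxA. Qed.
Lemma SL2_mul1 (R : realType) : left_id (SL2_one R) (@SL2_mul R).
Proof. by move=> A; apply/val_inj; rewrite /= mul1mx. Qed.
Lemma SL2_mulr1 (R : realType) : right_id (SL2_one R) (@SL2_mul R).
Proof. by move=> A; apply/val_inj; rewrite /= mulmx1. Qed.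
Lemma SL2_mulV (R : realType) :
  left_inverse (SL2_one R) (@SL2_inv R) (@SL2_mul R).
Proof.
by move=> A; apply/val_inj; rewrite /= mul_adj_mx (eqP (valP A)).
Qed.
Lemma SL2_mulrV (R : realType) :
  right_inverse (SL2_one R) (@SL2_inv R) (@SL2_mul R).
Proof.
by move=> A; apply/val_inj; rewrite /= mul_mx_adj (eqP (valP A)).
Qed.

HB.instance Definition _ (R : realType) :=
  isGroup.Build (SL2 R) (@SL2_mulA R) (@SL2_mul1 R) (@SL2_mulr1 R)
    (@SL2_mulV R) (@SL2_mulrV R).

Definition pm_eq (R : realType) (A B : SL2 R) : bool :=
  (val A == val B) || (val A == - val B).

Lemma pm_eq_refl (R : realType) : reflexive (@pm_eq R).
Proof. by move=> A; rewrite /pm_eq eqxx. Qed.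
Lemma pm_eq_sym (R : realType) : symmetric (@pm_eq R).
Proof.
by move=> A B; rewrite /pm_eq eq_sym; congr (_ || _); rewrite eq_sym eqr_oppLR.
Qed.
Lemma pm_eq_trans (R : realType) : transitive (@pm_eq R).
Proof.
move=> B A C; rewrite /pm_eq => /orP[]/eqP -> /orP[]/eqP ->;
by rewrite ?opprK eqxx ?orbT.
Qed.

Canonical pm_eq_equiv (R : realType) : equiv_rel (SL2 R) :=
  EquivRel (@pm_eq R) (@pm_eq_refl R) (@pm_eq_sym R) (@pm_eq_trans R).

(* PSL(2,C) = SL(2,C)/{1,-1} with the quotient topology. *)
Definition PSL2 (R : realType) : Type :=
  quotient_topology {eq_quot (pm_eq_equiv R)}.

HB.instance Definition _ (R : realType) :=
  Quotient.copy (PSL2 R) (quotient_topology {eq_quot (pm_eq_equiv R)}).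
HB.instance Definition _ (R : realType) :=
  Topological.copy (PSL2 R) (quotient_topology {eq_quot (pm_eq_equiv R)}).


Definition PSL2_one (R : realType) : PSL2 R := \pi_(PSL2 R) (1%g : SL2 R).
Definition PSL2_inv (R : realType) (g : PSL2 R) : PSL2 R :=
  \pi_(PSL2 R) (repr g)^-1%g.
Definition PSL2_mul (R : realType) (g h : PSL2 R) : PSL2 R :=
  \pi_(PSL2 R) (repr g * repr h)%g.


Lemma PSL2_piP (R : realType) (A B : SL2 R) :
  reflect (\pi_(PSL2 R) A = \pi_(PSL2 R) B) (pm_eq A B).
Proof. exact: (@eqmodP _ (pm_eq_equiv R) A B). Qed.

Lemma PSL2_piM (R : realType) (A B : SL2 R) :
  PSL2_mul (\pi_(PSL2 R) A) (\pi_(PSL2 R) B) = \pi_(PSL2 R) (A * B)%g.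
Proof.
apply/PSL2_piP.
have /PSL2_piP := reprK (\pi_(PSL2 R) A).
have /PSL2_piP := reprK (\pi_(PSL2 R) B).
rewrite /pm_eq /=.
by move=> /orP[]/eqP-> /orP[]/eqP->;
  rewrite ?mulmxN ?mulNmx ?opprK eqxx ?orbT.
Qed.

Lemma PSL2_pi_surj (R : realType) (g : PSL2 R) :
  exists A : SL2 R, g = \pi_(PSL2 R) A.
Proof. by exists (repr g); rewrite reprK. Qed.

Lemma PSL2_mulA (R : realType) : associative (@PSL2_mul R).
Proof.
move=> f g h.
have [[A ->] [B ->]] := (PSL2_pi_surj f, PSL2_pi_surj g).
by have [C ->] := PSL2_pi_surj h; rewrite !PSL2_piM mulgA.
Qed.
Lemma PSL2_mul1 (R : realType) : left_id (PSL2_one R) (@PSL2_mul R).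
Proof. by move=> g; have [A ->] := PSL2_pi_surj g; rewrite PSL2_piM mul1g. Qed.
Lemma PSL2_mulr1 (R : realType) : right_id (PSL2_one R) (@PSL2_mul R).
Proof. by move=> g; have [A ->] := PSL2_pi_surj g; rewrite PSL2_piM mulg1. Qed.
Lemma PSL2_mulV (R : realType) :
  left_inverse (PSL2_one R) (@PSL2_inv R) (@PSL2_mul R).
Proof.
by move=> g; rewrite -[X in PSL2_mul _ X]reprK PSL2_piM mulVg.
Qed.
Lemma PSL2_mulrV (R : realType) :
  right_inverse (PSL2_one R) (@PSL2_inv R) (@PSL2_mul R).
Proof.
by move=> g; rewrite -[X in PSL2_mul X _]reprK PSL2_piM mulgV.
Qed.

HB.instance Definition _ (R : realType) :=
  isGroup.Build (PSL2 R) (@PSL2_mulA R) (@PSL2_mul1 R) (@PSL2_mulr1 R)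
    (@PSL2_mulV R) (@PSL2_mulrV R).

Definition PSL2_act (R : realType) (g : PSL2 R) : sphere R -> sphere R :=
  mobius (val (repr g)).

Lemma mobiusN (R : realType) (A : 'M[R[i]]_2) : mobius (- A) =1 mobius A.
Proof.
move=> [z|] /=; rewrite !mxE; last by rewrite oppr_eq0 invrN mulrNN.
by rewrite !mulNr -!opprD oppr_eq0 invrN mulrNN.
Qed.

Lemma PSL2_act_pi (R : realType) (A : SL2 R) :
  PSL2_act (\pi_(PSL2 R) A) =1 mobius (val A).
Proof.
move=> x; rewrite /PSL2_act.
have /PSL2_piP := reprK (\pi_(PSL2 R) A).
by move=> /orP[] /eqP -> //; exact: mobiusN.
Qed.

Lemma SL2_det (R : realType) (A : SL2 R) :
  val A 0 0 * val A 1 1 - val A 0 1 * val A 1 0 = 1.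
Proof.
rewrite -[RHS](eqP (valP A)) (expand_det_row _ 0) !big_ord_recl big_ord0.
rewrite /cofactor !det_mx11 !mxE /= expr0 expr1 mul1r mulN1r mulrN addr0.
by congr (_ * _ - _ * _); congr (val A _ _); apply/val_inj.
Qed.

Lemma mobiusM (R : realType) (A B : SL2 R) (x : sphere R) :
  mobius (val (A * B)%g) x = mobius (val A) (mobius (val B) x).
Proof.
have := SL2_det A; have := SL2_det B.
have E i j : val (A * B)%g i j = val A i 0 * val B 0 j + val A i 1 * val B 1 j.
  rewrite /= mxE !big_ord_recl big_ord0 addr0.
  by rewrite (_ : lift ord0 ord0 = 1) //; apply/val_inj.
rewrite /mobius !E.
move: (val A 0 0) (val A 0 1) (val A 1 0) (val A 1 1) => a b c d.
move: (val B 0 0) (val B 0 1) (val B 1 0) (val B 1 1) => e f g h dB dA.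
case: x => [z|]; last first.
  have [g0|g0] := eqVneq g 0.
    have e0 : e != 0.
      apply/eqP => e0; move/eqP: dB.
      by rewrite e0 g0 mul0r mulr0 subr0 eq_sym oner_eq0.
    rewrite g0 !mulr0 !addr0 mulf_eq0 (negPf e0) orbF.
    case: eqVneq => // c0; congr Some; field; exact/andP.
  have -> : c * (e / g) + d = (c * e + d * g) / g by field.
  rewrite mulf_eq0 invr_eq0 (negPf g0) orbF.
  case: eqVneq => // n0; congr Some; field; exact/andP.
have [g0|g0] := eqVneq (g * z + h) 0.
  have e0 : e * z + f != 0.
    apply/eqP => e0; move/eqP: dB.
    have -> : h = - (g * z) by apply/eqP; rewrite -addr_eq0 addrC g0.
    have -> : f = - (e * z) by apply/eqP; rewrite -addr_eq0 addrC e0.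
    by rewrite (_ : _ - _ = 0) ?[0 == 1]eq_sym ?oner_eq0 //; ring.
  have -> : (c * e + d * g) * z + (c * f + d * h) =
    c * (e * z + f) + d * (g * z + h) by ring.
  have -> : (a * e + b * g) * z + (a * f + b * h) =
    a * (e * z + f) + b * (g * z + h) by ring.
  rewrite g0 !mulr0 !addr0 mulf_eq0 (negPf e0) orbF.
  case: eqVneq => // c0; congr Some.
  by rewrite -mulf_div divff // mulr1.
have -> : c * ((e * z + f) / (g * z + h)) + d =
  ((c * e + d * g) * z + (c * f + d * h)) / (g * z + h) by field.
rewrite mulf_eq0 invr_eq0 (negPf g0) orbF.
case: eqVneq => // n0; congr Some; field.
by apply/andP.
Qed.

Lemma PSL2_actM (R : realType) (g h : PSL2 R) (x : sphere R) :
  PSL2_act (g * h)%g x = PSL2_act g (PSL2_act h x).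
Proof.
rewrite -[g]reprK -[h]reprK.
by rewrite [(_ * _)%g]PSL2_piM !PSL2_act_pi mobiusM.
Qed.

Lemma PSL2_act1 (R : realType) (x : sphere R) : PSL2_act 1%g x = x.
Proof.
rewrite [LHS]PSL2_act_pi; case: x => [z|] /=; rewrite !mxE /= ?eqxx //.
by rewrite mul0r add0r oner_eq0 mul1r addr0 divr1.
Qed.
Definition lebesgue2 (R : realType) :=
  (@lebesgue_measure R \x @lebesgue_measure R)%E.
Arguments lebesgue2 R : clear implicits.

Definition mixed_partial (R : realType) (a b : nat) (phi : R * R -> R)
    : R * R -> R :=
  iter a (fun h x => 'D_((1, 0) : R * R) h x)
    (iter b (fun h x => 'D_((0, 1) : R * R) h x) phi).

Definition test_function (R : realType) (W : set (R * R)) (phi : R * R -> R)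
    : Prop :=
  smooth_on setT phi /\
  exists K : set (R * R),
    [/\ compact K, K `<=` W & forall x, ~ K x -> phi x = 0].

Definition Lp_loc (R : realType) (p : R) (W : set (R * R)) (u : R * R -> R)
    : Prop :=
  measurable_fun W u /\
  forall K : set (R * R), compact K -> K `<=` W ->
    (\int[lebesgue2 R]_(x in K) (`|u x| `^ p)%:E < +oo)%E.

Definition weak_partial (R : realType) (W : set (R * R)) (a b : nat)
    (u v : R * R -> R) : Prop :=
  forall phi : R * R -> R, test_function W phi ->
    (\int[lebesgue2 R]_(x in W) (u x * mixed_partial a b phi x)%:E =
     ((-1) ^+ (a + b))%:E * \int[lebesgue2 R]_(x in W) (v x * phi x)%:E)%E.

(* For a + b = 0 the condition says that [u] itself is locally L^p. *)
Definition sobolev_loc (R : realType) (k : nat) (p : R) (W : set (R * R))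
    (u : R * R -> R) : Prop :=
  forall a b : nat, (a + b <= k)%N ->
    exists2 v, Lp_loc p W v & weak_partial W a b u v.

(* The two holomorphic coordinates of the Riemann sphere, z (b = false) and
   1/z (b = true), as parametrizations by the real plane. *)
Definition sphere_param (R : realType) (b : bool) (w : R * R) : sphere R :=
  let z := w.1 +i* w.2 in
  if b then (if z == 0 then None else Some z^-1) else Some z.

(* L^p_k-maps from the sphere to a manifold.  Since k - 2/p > 1 such maps are
   continuous, so the composites with charts are defined on open sets, and
   being of class L^p_k is tested locally in charts of both sides; the sphere
   being compact, neither the charts nor the area form matter. *)
Definition Lpk_map (R : realType) (n : nat) (M : topologicalType)
    (A : smooth_atlas R n M) (k : nat) (p : R) (f : sphere R -> M) : Prop :=
  continuous f /\
  forall (b : bool) (i : chart_idx A) (j : 'I_n),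
    sobolev_loc k p [set w | dom i (f (sphere_param b w))]
      (fun w => chart i (f (sphere_param b w)) 0 j).

Definition fixing (R : realType) (X : set (sphere R)) : set (PSL2 R) :=
  [set g | forall x, X x -> PSL2_act g x = x].

(* G_0, G_1 and G_2; all three are closed in [PSL2 R], so their Lie group
   topology is the induced one. *)
Definition reparam_group (R : realType) (G : set (PSL2 R)) : Prop :=
  [\/ G = setT,
      exists x1, G = fixing [set x1] |
      exists x1 x2, x1 <> x2 /\ G = fixing [set x1; x2]].

Definition stab (R : realType) (M : Type) (G : set (PSL2 R))
    (f : sphere R -> M) : set (PSL2 R) :=
  [set g | G g /\ f \o PSL2_act g = f].

(* Main.v *)
Require Import Defs.
From HB Require Import structures.
From mathcomp Require Import all_boot all_order all_algebra.
From mathcomp Require Import complex ring.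
From mathcomp Require Import all_classical all_reals all_analysis.

Import Order.TTheory GRing.Theory Num.Theory.
Import numFieldNormedType.Exports.

Local Open Scope classical_set_scope.
Local Open Scope ring_scope.

(** If the lifts to SL(2,C) of the elements of the stabilizer were unbounded, the
    normalized matrices A_n/|A_n| would have a cluster point B <> 0 with
    det B = lim |A_n|^-2 = 0.  Such a B sends all points of the sphere, except at
    most one, to a single point y.  Mobius maps depend continuously on the matrix
    away from the kernel, so f x = f (A_n x) gives f x = f y there, and f is
    constant by continuity. *)

(** * General topology: limits of equations, and compactness of sets of matrices *)

(** Continuity at the single point [x] suffices; this matters for Mobius maps, whose dependence on
    the matrix is controlled only away from the kernel. *)
Lemma closed_set1_eq (X Y : topologicalType) (h : X -> Y) (x : X) (y : Y) :
  closed [set y] -> {for x, continuous h} -> closure (h @^-1` [set y]) x ->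
  h x = y.
Proof.
move=> cy hx clx; apply: cy => U hU.
by have [x' [/= hx' Ux']] := clx _ (hx _ hU); exists (h x').
Qed.

(** Tychonoff for finitely many entries: along an ultrafilter every entry converges, and the matrix
    of these limits is the limit. *)
Lemma mx_compact (T : topologicalType) (m n : nat)
    (K : 'I_m -> 'I_n -> set T) :
  (forall i j, compact (K i j)) ->
  compact [set A : 'M[T]_(m, n) | forall i j, K i j (A i j)].
Proof.
move=> cK; rewrite compact_ultra => F FU FK.
have FP : ProperFilter F := ultra_proper.
have lim i j : {a : T | K i j a /\ (fun A : 'M[T]_(m, n) => A i j) @ F --> a}.
  apply: cid.
  have [|a [Ka clFa]] := cK i j ((fun A : 'M[T]_(m, n) => A i j) @ F) _.
    by rewrite /fmap /=; apply: filterS FK => A; apply.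
  exists a; split => // V Va; rewrite nbhs_filterE.
  pose coord (A : 'M[T]_(m, n)) := A i j.
  (* If the ultrafilter contained the complement instead, [V] would miss a set that the cluster
     point [a] must meet. *)
  have [//|FnV] := in_ultra_setVsetC (coord @^-1` V) FU.
  by have [t []] := clFa (~` V) V FnV Va.
exists (\matrix_(i, j) projT1 (lim i j)); split => /= [i j|U].
  by rewrite mxE; have [] := projT2 (lim i j).
case=> P nP PU; rewrite nbhs_filterE.
apply: filterS (PU) _.
apply: filter_forall => i; apply: filter_forall => j.
have [_] := projT2 (lim i j).
by apply; have := nP i j; rewrite mxE.
Qed.

(** A cluster point of the image filter lies in [K], hence lifts to [S]; the lift is a cluster point
    because open sets of [S] are preimages of open sets. *)
Lemma initial_compact (S : choiceType) (T : topologicalType) (h : S -> T)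
    (K : set T) : K `<=` range h -> compact K ->
  compact (h @^-1` K : set (initial_topology h)).
Proof.
move=> Kh cK F PF FK.
have [|y [Ky clFy]] := cK (h @ F) _; first exact: FK.
have [s _ hs] := Kh _ Ky; exists s; split; first by rewrite /= hs.
move=> B D FB [_ [[V oV <-] Vs VD]].
have [||z [hBz Vz]] := clFy (h @` B) V.
- by rewrite /fmap /=; apply: filterS FB => b Bb; exists b.
- by apply: open_nbhs_nbhs; split => //; rewrite -hs.
by case: hBz Vz => b Bb <- Vb; exists b; split => //; apply: VD.
Qed.

Lemma pair_continuous (X Y : topologicalType) (x : X) :
  continuous (pair x : Y -> X * Y).
Proof. by move=> y; apply: cvg_pair; [exact: cvg_cst|exact: cvg_id]. Qed.

(** * Topology of the complex plane and Heine-Borel for complex matrices *)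

Section Sphere.
Variable R : realType.
Local Notation C := R[i].

Lemma coord_cvg (A : 'M[C]_2) (i j : 'I_2) :
  (fun B : 'M[C]_2 => B i j) @ A --> A i j.
Proof. exact: coord_continuous. Qed.

(** The order on [R[i]] is partial and its positive elements are real, so a complex epsilon can be
    traded for a real one. *)
Lemma gt0_complex (e : C) :
  0 < e -> 0 < complex.Re e /\ e = (complex.Re e)%:C%C.
Proof. by case: e => a b; rewrite ltcE /= => /andP[/eqP-> a0]. Qed.

Lemma real_complex_continuous : continuous (fun x : R => x%:C%C : C).
Proof.
move=> x; apply/cvgrPdist_lt => e e0.
have [re ->] := gt0_complex _ e0.
near=> y; rewrite -rmorphB normc_def /= expr0n addr0 sqrtr_sqr ltcR.
by near: y; exact: cvgr_dist_lt.
Unshelve. all: by end_near. Qed.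

Lemma rectangular_continuous :
  continuous (fun w : R * R => (w.1 +i* w.2)%C : C).
Proof.
move=> w.
have -> : (fun w : R * R => (w.1 +i* w.2)%C : C) =
    (fun w : R * R => w.1%:C%C + 'i%C * w.2%:C%C).
  apply/funext => -[a b] /=; apply/eqP; rewrite eq_complex /=.
  by rewrite !(mul0r, mul1r, mulr0, addr0, add0r, subr0) !eqxx.
have c1 : (fun w : R * R => w.1%:C%C : C) @ w --> w.1%:C%C.
  apply: continuous_comp; first exact: cvg_fst.
  exact: real_complex_continuous.
have c2 : (fun w : R * R => w.2%:C%C : C) @ w --> w.2%:C%C.
  apply: continuous_comp; first exact: cvg_snd.
  exact: real_complex_continuous.
apply: (cvgD c1); apply: cvgM c2; exact: cvg_cst.
Qed.

Lemma box_compact (r : R) :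
  compact [set z : C | `|complex.Re z| <= r /\ `|complex.Im z| <= r].
Proof.
have -> : [set z : C | `|complex.Re z| <= r /\ `|complex.Im z| <= r] =
    (fun w : R * R => (w.1 +i* w.2)%C) @` (`[-r, r] `*` `[-r, r]).
  apply/seteqP; split => [[a b] /= [ha hb]|_ [[a b] /= [ha hb] <-]].
    by exists (a, b) => //=; rewrite !in_itv /= -!ler_norml.
  by move: ha hb; rewrite !in_itv /= -!ler_norml.
apply: continuous_compact.
  exact/continuous_subspaceT/rectangular_continuous.
by apply: compact_setX; exact: segment_compact.
Qed.

(** The matrix norm is the maximum of the entry norms, so [S] is a closed subset of a product of
    compact squares. *)
Lemma mx_bounded_compact (m n : nat) (r : R) (S : set 'M[C]_(m, n)) :
  closed S -> (forall A, S A -> `|A| <= r%:C%C) -> compact S.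
Proof.
move=> cS bS.
have cB := @mx_compact C m n (fun _ _ => _) (fun _ _ => box_compact r).
apply: (subclosed_compact cS cB) _.
move=> A /bS Ar i j.
have Aij : `|A i j| <= r%:C%C.
  apply: le_trans Ar; rewrite {2}/Num.norm /= mx_normE.
  rewrite -[leLHS]nngE num_le.
  exact: (le_bigmax _ (fun ij : 'I_m * 'I_n => `|A ij.1 ij.2|%:nng) (i, j)).
split; rewrite -lecR.
  exact: le_trans (normc_ge_Re _) Aij.
apply: le_trans Aij; rewrite normc_def lecR -sqrtr_sqr ler_wsqrtr //.
by rewrite lerDr sqr_ge0.
Qed.

(** * Homogeneous coordinates: the sphere as the projective line *)

Definition homog (x : sphere R) : C * C :=
  if x is Some z then (z, 1) else (1, 0).
(* The pair (0, 0) is sent to infinity. *)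
Definition of_homog (p : C * C) : sphere R :=
  if p.2 == 0 then None else Some (p.1 / p.2).
Definition mxapp (A : 'M[C]_2) (p : C * C) : C * C :=
  (A 0 0 * p.1 + A 0 1 * p.2, A 1 0 * p.1 + A 1 1 * p.2).

(** Splits the action into a part linear in [A] and a projection that is continuous off the
    origin. *)
Lemma mobiusE (A : 'M[C]_2) x : mobius A x = of_homog (mxapp A (homog x)).
Proof.
by case: x => [z|]; rewrite /mobius /of_homog /= ?mulr1 ?mulr0 ?addr0.
Qed.

Lemma of_homog_continuous (p : C * C) :
  p != 0 -> {for p, continuous of_homog}.
Proof.
case: p => a b p0.
have [b0|b0] := eqVneq b 0; last first.
  have -> : {for (a, b), continuous of_homog} =
      (of_homog @ (a, b) --> (Some (a / b) : sphere R)).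
    by rewrite /prop_for /continuous_at {2}/of_homog /= (negbTE b0).
  have h : (fun q : C * C => q.1 / q.2) @ (a, b) --> a / b.
    apply: cvgM; first exact: cvg_fst.
    by apply: cvgV => //; exact: cvg_snd.
  move=> U /h; rewrite !near_simpl => hU.
  have nb : \forall q \near (a, b), (q : C * C).2 != 0.
    have h2 : (fun q : C * C => q.2) @ (a, b) --> b by exact: cvg_snd.
    exact: (cvgr_neq0 _ h2 b0).
  near=> q.
  rewrite /= /of_homog ifF; last by apply/negbTE; near: q.
  by near: q.
have -> : {for (a, b), continuous of_homog} =
      (of_homog @ (a, b) --> (None : sphere R)).
  by rewrite /prop_for /continuous_at {2}/of_homog /= b0 eqxx.
have a0 : a != 0 by move: p0; rewrite b0; apply: contraNneq => ->.
move=> U [K [cK _] KU].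
(* A neighbourhood of infinity contains the complement of a compact [K]. Compactness makes the
   condition q.1 <> z q.2 hold for all [z] in [K] at once when q is near (a, 0), so q.1 / q.2 avoids
   [K]. *)
have /compact_near_coveringP := cK.
move=> /(_ _ (nbhs (a, b)) (fun q z => (q : C * C).1 - z * q.2 != 0) _) nK.
have {}nK : \forall q \near (a, b),
    K `<=` (fun z => (q : C * C).1 - z * q.2 != 0).
  apply: nK => z Kz.
  have h : (fun w : C * (C * C) => w.2.1 - w.1 * w.2.2) @ (z, (a, b)) -->
      a - z * b.
    have c2 : (fun w : C * (C * C) => w.2) @ (z, (a, b)) --> (a, b).
      exact: cvg_snd.
    apply: cvgB.
      by apply: (cvg_comp _ _ c2); exact: cvg_fst.
    apply: cvgM; first exact: cvg_fst.
    by apply: (cvg_comp _ _ c2); exact: cvg_snd.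
  apply: (cvgr_neq0 _ h).
  by rewrite b0 mulr0 subr0.
rewrite nbhs_filterE /=.
near=> q.
apply: KU; rewrite /of_homog; case: eqVneq => q0; first by right.
left; exists (q.1 / q.2) => // Kq.
have : K `<=` (fun z => q.1 - z * q.2 != 0) by near: q.
by move=> /(_ _ Kq); rewrite divfK // subrr eqxx.
Unshelve. all: by end_near. Qed.

Lemma of_homog_eq (p q : C * C) :
  p != 0 -> q != 0 -> p.1 * q.2 = p.2 * q.1 -> of_homog p = of_homog q.
Proof.
case: p q => [a b] [c d]; rewrite /of_homog /= => p0 q0 e.
case: (eqVneq b 0) e p0 => [->|b0] e p0.
  have a0 : a != 0 by apply: contraNneq p0 => ->.
  move/eqP: e; rewrite mul0r mulf_eq0 (negbTE a0) /= => /eqP ->.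
  by rewrite eqxx.
case: (eqVneq d 0) e q0 => [->|d0] e q0.
  have c0 : c != 0 by apply: contraNneq q0 => ->.
  by move/eqP: e; rewrite mulr0 eq_sym mulf_eq0 (negbTE c0) (negbTE b0).
by congr Some; apply/eqP; rewrite eqr_div // e mulrC.
Qed.

(** * Kernels, degenerate matrices and scaling *)

Lemma mx2_det (A : 'M[C]_2) : \det A = A 0 0 * A 1 1 - A 0 1 * A 1 0.
Proof.
rewrite (expand_det_row _ 0) !big_ord_recl big_ord0.
rewrite /cofactor !det_mx11 !mxE /= expr0 expr1 mul1r mulN1r mulrN addr0.
by congr (_ * _ - _ * _); congr (A _ _); apply/val_inj.
Qed.

Lemma mx2_eq0 (A : 'M[C]_2) :
  A 0 0 = 0 -> A 0 1 = 0 -> A 1 0 = 0 -> A 1 1 = 0 -> A = 0.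
Proof.
move=> a b c d; apply/matrixP => -[[|[|//]] i] [[|[|//]] j]; rewrite mxE.
- by rewrite -[RHS]a; congr (A _ _); apply/val_inj.
- by rewrite -[RHS]b; congr (A _ _); apply/val_inj.
- by rewrite -[RHS]c; congr (A _ _); apply/val_inj.
- by rewrite -[RHS]d; congr (A _ _); apply/val_inj.
Qed.

Lemma homog_inj x x' :
  (homog x).1 * (homog x').2 - (homog x).2 * (homog x').1 = 0 -> x = x'.
Proof.
case: x x' => [z|] [z'|] //=; rewrite ?mulr1 ?mul1r ?mulr0 ?mul0r ?subr0 ?sub0r.
- by move/eqP; rewrite subr_eq0 => /eqP ->.
- by move/eqP; rewrite oppr_eq0 oner_eq0.
- by move/eqP; rewrite oner_eq0.
Qed.

Lemma homog_neq0 x : homog x != 0.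
Proof. by case: x => [z|]; rewrite xpair_eqE oner_eq0 ?andbF. Qed.

(** Representatives of two distinct points form a basis of C^2, and a matrix killing a basis is
    zero. *)
Lemma mxapp_ker_uniq (A : 'M[C]_2) x x' : A != 0 ->
  mxapp A (homog x) = 0 -> mxapp A (homog x') = 0 -> x = x'.
Proof.
move=> A0 [h1 h2] [h3 h4]; apply: homog_inj.
move: h1 h2 h3 h4; move: (homog x) (homog x') => [u v] [u' v'] /= h1 h2 h3 h4.
apply/eqP; apply: contraNT A0 => D0; apply/eqP.
(* Cramer's rule: each entry times the determinant of the two representatives is a combination of
   the vanishing coordinates. *)
apply: mx2_eq0; apply: (mulIf D0); rewrite mul0r.
- rewrite [LHS](_ : _ = v' * (A 0 0 * u + A 0 1 * v) -
      v * (A 0 0 * u' + A 0 1 * v')).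
    by rewrite h1 h3 !mulr0 subr0.
  by ring.
- rewrite [LHS](_ : _ = u * (A 0 0 * u' + A 0 1 * v') -
      u' * (A 0 0 * u + A 0 1 * v)).
    by rewrite h1 h3 !mulr0 subr0.
  by ring.
- rewrite [LHS](_ : _ = v' * (A 1 0 * u + A 1 1 * v) -
      v * (A 1 0 * u' + A 1 1 * v')).
    by rewrite h2 h4 !mulr0 subr0.
  by ring.
- rewrite [LHS](_ : _ = u * (A 1 0 * u' + A 1 1 * v') -
      u' * (A 1 0 * u + A 1 1 * v)).
    by rewrite h2 h4 !mulr0 subr0.
  by ring.
Qed.

(** Applying the adjugate to A p gives det A times p. *)
Lemma mxapp_neq0 (A : 'M[C]_2) p : \det A != 0 -> p != 0 -> mxapp A p != 0.
Proof.
rewrite mx2_det; case: p => u v D0; apply: contraNneq => -[/= h1 h2].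
rewrite xpair_eqE; apply/andP; split; apply/eqP; apply: (mulfI D0); rewrite mulr0.
  rewrite [LHS](_ : _ = A 1 1 * (A 0 0 * u + A 0 1 * v) -
      A 0 1 * (A 1 0 * u + A 1 1 * v)).
    by rewrite h1 h2 !mulr0 subr0.
  by ring.
rewrite [LHS](_ : _ = A 0 0 * (A 1 0 * u + A 1 1 * v) -
      A 1 0 * (A 0 0 * u + A 0 1 * v)).
  by rewrite h1 h2 !mulr0 subr0.
by ring.
Qed.

(** The cross product of A p and A p' is det A times that of p and p', so the two images are
    proportional. *)
Lemma mobius_det0 (A : 'M[C]_2) x x' : \det A = 0 ->
  mxapp A (homog x) != 0 -> mxapp A (homog x') != 0 ->
  mobius A x = mobius A x'.
Proof.
rewrite mx2_det !mobiusE => D0 h h'; apply: of_homog_eq => //=.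
apply/eqP; rewrite -subr_eq0; apply/eqP.
rewrite [LHS](_ : _ = (A 0 0 * A 1 1 - A 0 1 * A 1 0) *
  ((homog x).1 * (homog x').2 - (homog x).2 * (homog x').1)); last by ring.
by rewrite D0 mul0r.
Qed.

(** Allows matrices to be normalized to norm 1, which takes them out of SL(2,C). *)
Lemma mobius_scale (t : C) (A : 'M[C]_2) x :
  t != 0 -> mobius (t *: A) x = mobius A x.
Proof.
move=> t0; rewrite !mobiusE /of_homog /= !mxE -!mulrA -!mulrDr.
rewrite mulf_eq0 (negbTE t0) /=; case: eqVneq => // d0.
by rewrite -mulf_div divff // mul1r.
Qed.

(** * Continuous dependence on the matrix *)

Lemma mx2_det_continuous : continuous (fun A : 'M[C]_2 => \det A).
Proof.
have -> : (fun A : 'M[C]_2 => \det A) =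
    fun A => A 0 0 * A 1 1 - A 0 1 * A 1 0.
  by apply/funext => A; exact: mx2_det.
move=> A.
have c i j := @coord_cvg A i j.
exact: (cvgB (cvgM (c _ _) (c _ _)) (cvgM (c _ _) (c _ _))).
Qed.

Lemma mobius_continuous x (A : 'M[C]_2) : mxapp A (homog x) != 0 ->
  {for A, continuous (fun B => mobius B x)}.
Proof.
move=> A0.
have -> : (fun B => mobius B x) = of_homog \o (fun B => mxapp B (homog x)).
  by apply/funext => B; exact: mobiusE.
apply: continuous_comp; last exact: of_homog_continuous.
have c i j (a : C) : (fun B : 'M[C]_2 => B i j * a) @ A --> A i j * a.
  exact: (cvgM (@coord_cvg A i j) (cvg_cst a)).
exact: (cvg_pair (cvgD (c _ _ _) (c _ _ _)) (cvgD (c _ _ _) (c _ _ _))).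
Qed.

Lemma mobius_closure (Y : topologicalType) (h : sphere R -> Y) (y : Y) x
    (A : 'M[C]_2) : closed [set y] -> continuous h ->
  mxapp A (homog x) != 0 -> closure [set B | h (mobius B x) = y] A ->
  h (mobius A x) = y.
Proof.
move=> cy ch A0 clA.
apply: (@closed_set1_eq _ _ (fun B => h (mobius B x)) A y) => //.
apply: (@continuous_comp _ _ _ (fun B => mobius B x)); last exact: ch.
exact: mobius_continuous.
Qed.

(** * Points of the sphere are closed and not isolated *)

Lemma sphere_closed1 (x : sphere R) : closed [set x].
Proof.
have hC : hausdorff_space C := @norm_hausdorff _ C.
rewrite -[X in closed X]setCK; apply: open_closedC.
case: x => [z|].
  have cz : closed [set z] by exact/accessible_closed_set1/hausdorff_accessible.
  rewrite openE => -[w|] /= wz; last first.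
    exists [set z]; first by split => //; exact: compact_set1.
    by move=> _ [[w wz' <-] [] // e|-> //]; apply: wz'.
  have : nbhs w (~` [set z]).
    apply: open_nbhs_nbhs; split; first exact: closed_openC.
    by move=> /= e; apply: wz; rewrite e.
  by apply: filterS => v vz [] e; apply: vz.
have -> : ~` [set None] = Some @` [set: C] :> set (sphere R).
  by apply/seteqP; split => [[z|]//= _|_ [z _ <-]//]; exists z.
exact/one_point_compactification_open_some/openT.
Qed.

Lemma sphere_not_isolated (x : sphere R) : closure (~` [set x]) x.
Proof.
move=> U.
(* It is enough to approach [x] along a punctured disc: by z + t at a finite point, by [1 : t] at
   infinity. *)
suff [h [hx ch hn]] : exists h : C -> sphere R,
    [/\ h 0 = x, {for 0, continuous h} & forall t, t != 0 -> h t != x].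
  rewrite -hx => /ch; rewrite nbhs_filterE => hU.
  have [t [ht t0]] : exists t, U (h t) /\ t != 0.
    have : (0:C)^' (h @^-1` U `&` [set t | t != 0]).
      apply: filterI; first exact: nbhs_dnbhs.
      by near=> t; near: t; exact: nbhs_dnbhs_neq.
    by move=> /filter_ex[t [? ?]]; exists t.
  exists (h t); split => //; apply/eqP; rewrite hx; exact: hn.
case: x => [z|].
  exists (fun t => Some (z + t)); split; first by rewrite addr0.
    apply: (@continuous_comp _ _ _ (fun t => z + t) (Some : C -> sphere R)).
      exact: (@cvgD C C C (nbhs (0 : C)) _ (fun=> z) id z 0 (cvg_cst z) cvg_id).
    exact: one_point_compactification_some_continuous.
  by move=> t; apply: contra => /eqP[/(canRL (addKr _))]; rewrite addNr => ->.
exists (fun t => of_homog (1, t)); split; first by rewrite /of_homog eqxx.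
  apply: (@continuous_comp _ _ _ (pair (1 : C)) of_homog).
    exact: pair_continuous.
  by apply: of_homog_continuous; rewrite xpair_eqE oner_eq0.
by move=> t t0; rewrite /of_homog /= (negbTE t0).
Unshelve. all: by end_near. Qed.

(** * The stabilizer lifted to matrices: closed, bounded, hence compact *)

Section Stabilizer.
Variables (M : topologicalType) (f : sphere R -> M) (X : set (sphere R)).
Hypothesis closedM : forall y : M, closed [set y].
Hypothesis f_cts : continuous f.

(** The lift lives in the full matrix space, where compactness follows from closedness and
    boundedness. *)
Definition stab_mx : set 'M[C]_2 :=
  [set A | [/\ \det A = 1, forall x, X x -> mobius A x = x &
               forall x, f (mobius A x) = f x]].

Lemma stab_mx_closed : closed stab_mx.
Proof.
move=> A clA.
have sub (P : set 'M[C]_2) : stab_mx `<=` P -> closure P A.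
  by move=> SP; apply: closureS clA.
(* The determinant condition goes to the limit first: it excludes a kernel, so the other two
   conditions are continuous at [A]. *)
have dA : \det A = 1.
  apply: (@closed_set1_eq 'M[C]_2 C (fun B : 'M[C]_2 => \det B)).
  - exact/accessible_closed_set1/hausdorff_accessible/norm_hausdorff.
  - exact: mx2_det_continuous.
  - by apply: sub => B [].
have A0 x : mxapp A (homog x) != 0.
  by apply: mxapp_neq0 (homog_neq0 x); rewrite dA oner_eq0.
split => // [x Xx|x].
  apply: (@mobius_closure _ id) => //; [exact: sphere_closed1|by move=> ?|].
  by apply: sub => B [_ /(_ _ Xx)].
by apply: (@mobius_closure _ f) => //; apply: sub => B [_ _ /(_ x)].
Qed.

Lemma cst_of_degenerate (B : 'M[C]_2) : B != 0 -> \det B = 0 ->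
  (forall x, mxapp B (homog x) != 0 -> f (mobius B x) = f x) ->
  exists c, f = cst c.
Proof.
move=> B0 dB fB.
have [x1 x1B] : exists x1, mxapp B (homog x1) != 0.
  have [e1|] := eqVneq (mxapp B (homog None)) 0; last by exists None.
  have [e2|] := eqVneq (mxapp B (homog (Some 0))) 0; last by exists (Some 0).
  (* The kernel cannot contain both infinity and 0. *)
  by have := mxapp_ker_uniq _ _ _ B0 e1 e2.
have fx x : mxapp B (homog x) != 0 -> f x = f x1.
  by move=> xB; rewrite -fB // -[RHS]fB // (mobius_det0 _ _ _ dB xB x1B).
exists (f x1); apply/funext => x.
have [e|/fx//] := eqVneq (mxapp B (homog x)) 0.
(* Here [x] is the kernel point. Every other point has value f x1, and these points accumulate at
   [x]. *)
apply: closed_set1_eq => //; first exact: f_cts.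
apply: closureS (@sphere_not_isolated x) => x' /= x'x.
apply: fx; apply/eqP => e'; apply: x'x; exact: mxapp_ker_uniq B0 e' e.
Qed.

Lemma stab_mx_bounded : (~ exists c, f = cst c) ->
  exists r : R, forall A, stab_mx A -> `|A| <= r%:C%C.
Proof.
move=> fN; apply: contrapT => unb; apply: fN.
have /choice[A HA] : forall n : nat, exists A, stab_mx A /\ n.+1%:R <= `|A|.
  move=> n; apply: contrapT => hn; apply: unb; exists n.+1%:R => A SA.
  rewrite rmorph_nat; apply: contrapT => /negP.
  rewrite -real_ltNge ?realn ?normr_real //.
  by move=> /ltW lt; apply: hn; exists A.
have A0 n : 0 < `|A n| by apply: lt_le_trans (proj2 (HA n)); rewrite ltr0n.
pose B n := `|A n|^-1 *: A n.
pose S := [set D : 'M[C]_2 | `|D| = 1].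
have SB n : `|B n| = 1.
  by rewrite normrZ normfV normr_id mulVf // gt_eqF.
have cS : compact S.
  apply: (@mx_bounded_compact _ _ 1); last by move=> D ->.
  move=> D clD; apply: closed_set1_eq clD.
    exact/accessible_closed_set1/hausdorff_accessible/norm_hausdorff.
  exact: norm_continuous.
have [|D [SD clD]] := cS (B @ \oo) _; first by exists 0%N => // n _; exact: SB.
(* The cluster point is used without extracting a subsequence: each of its neighbourhoods is visited
   at arbitrarily late indices. *)
have freq U N : nbhs D U -> exists2 n, (N <= n)%N & U (B n).
  move=> DU.
  have [|E [[n Nn <-] UE]] := clD [set B n | n in [set n | (N <= n)%N]] U _ DU.
    by exists N => // n Nn; exists n.
  by exists n.
have D0 : D != 0 by rewrite -normr_eq0 SD oner_eq0.
apply: (@cst_of_degenerate D) => // [|x xD]; last first.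
  apply: mobius_closure => // U /(freq _ 0%N)[n _ UBn]; exists (B n); split => //=.
  rewrite mobius_scale ?invr_eq0 ?gt_eqF //.
  by have [[]] := HA n.
(* The determinant is the inverse square of the norm of [A n], a norm at least n + 1; one factor is
   bounded by 1/(n + 1), the other by 1. *)
have dB n : `|\det (B n)| <= n.+1%:R^-1.
  have [[dA _ _] nA] := HA n.
  have -> : \det (B n) = `|A n|^-1 ^+ 2 by rewrite detZ dA mulr1.
  rewrite ger0_norm ?exprn_ge0 ?invr_ge0 // expr2.
  have i1 : `|A n|^-1 <= n.+1%:R^-1 by rewrite lef_pV2 ?posrE ?ltr0n.
  rewrite -[leRHS]mulr1 ler_pM ?invr_ge0 //.
  by apply: le_trans i1 _; rewrite invf_le1 ?ltr0n // ler1n.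
apply/eqP; apply/negPn/negP => dD.
pose e := `|\det D|; have e0 : 0 < e by rewrite normr_gt0.
(* From index [N] on, the determinants of [B n] have norm at most e/2, while some later one is
   within less than e/2 of det D, of norm e: a contradiction. *)
have [N hN] : exists N : nat, N.+1%:R^-1 <= e / 2.
  have [re eE] := gt0_complex _ e0.
  exists (Num.truncn (2 / complex.Re e)); set m := Num.truncn _.
  rewrite -[leRHS]invrK lef_pV2 ?posrE ?invr_gt0 ?divr_gt0 ?ltr0n // invf_div eE.
  rewrite -(rmorph_nat (@real_complex R) m.+1) -(rmorph_nat (@real_complex R) 2).
  rewrite -fmorph_div lecR.
  exact/ltW/truncnS_gt.
have := @cvgr_dist_lt _ _ _ _ _ _ _ (@mx2_det_continuous D) (e / 2).
rewrite divr_gt0 // => /(_ _ isT) /(freq _ N)[n Nn /=].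
apply/negP; rewrite -real_leNgt ?normr_real //; last first.
  by rewrite gtr0_real // divr_gt0.
rewrite [leLHS](_ : _ = e - e / 2); last by rewrite [X in X - _](splitr e) addrK.
apply: le_trans (lerB_dist _ _); rewrite lerB //.
apply: le_trans (dB n) _; apply: le_trans hN.
by rewrite lef_pV2 ?posrE ?ltr0n // ler_nat.
Qed.

Lemma stab_compact : (~ exists c, f = cst c) ->
  compact (stab (fixing X) f).
Proof.
move=> /stab_mx_bounded[r hr].
have cS := mx_bounded_compact _ _ _ _ stab_mx_closed hr.
(* Compactness is carried from matrices to SL(2,C), which has the initial topology, and then pushed
   forward by the continuous quotient map. *)
have -> : stab (fixing X) f =
    (\pi_(PSL2 R)%qT : SL2 R -> PSL2 R) @` ((val : SL2 R -> 'M[C]_2) @^-1` stab_mx).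
  apply/seteqP; split => [g|_ [A [dA XA fA] <-]].
    have [A ->] := PSL2_pi_surj g; move=> [XA fA]; exists A => //; split.
    - exact/eqP/(valP A).
    - by move=> x Xx; rewrite -PSL2_act_pi; exact: XA.
    - by move=> x; rewrite -PSL2_act_pi -[LHS]/((f \o PSL2_act _) x) fA.
  split; first by move=> x Xx; rewrite PSL2_act_pi; exact: XA.
  by apply/funext => x; rewrite /= PSL2_act_pi.
apply: continuous_compact.
  exact/continuous_subspaceT/pi_continuous.
(* Determinant 1 places [stab_mx] inside the range of [val]. *)
apply: initial_compact cS => A [dA _ _].
by exists (exist _ A (introT eqP dA)).
Qed.

End Stabilizer.
End Sphere.

(** * Uniform treatment of the three groups, the subgroup property and the conclusion *)

Lemma reparam_fixing (R : realType) (G : set (PSL2 R)) :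
  reparam_group G -> exists X, G = fixing X.
Proof.
case=> [->|[x ->]|[x [y [_ ->]]]]; [|by eexists|by eexists].
(* The full group is the pointwise fixer of the empty set. *)
by exists set0; apply/seteqP; split => // g _ x [].
Qed.

Lemma stab_group_closed (R : realType) (M : Type) (X : set (sphere R))
    (f : sphere R -> M) : group_closed [in stab (fixing X) f].
Proof.
split.
  rewrite inE; split; first by move=> x _; exact: PSL2_act1.
  by apply/funext => x /=; rewrite PSL2_act1.
move=> g h; rewrite !inE => -[gX fg] [hX fh].
have VK x : PSL2_act h (PSL2_act h^-1%g x) = x.
  by rewrite -PSL2_actM mulgV PSL2_act1.
have KV x : PSL2_act h^-1%g (PSL2_act h x) = x.
  by rewrite -PSL2_actM mulVg PSL2_act1.
split => [x Xx|].
  by rewrite PSL2_actM -{1}(hX x Xx) KV gX.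
apply/funext => x /=; rewrite PSL2_actM.
(* Invariance of [f] under [h], read at the point h^-1 x, gives invariance under h^-1. *)
by rewrite -[LHS]/((f \o PSL2_act g) _) fg -{1}fh /= VK.
Qed.

Theorem corollary1p1 (R : realType) (n : nat) (M : topologicalType)
  (A : smooth_atlas R n M) (metricM : riemannian_metric A)
  (compactM : compact [set: M]) (hausdorffM : hausdorff_space M)
  (second_countableM : @second_countable M)
  (k : nat) (p : R) (p_ge1 : 1 <= p) (kp : 1 < k%:R - 2 / p)
  (G : set (PSL2 R)) (G_reparam : reparam_group G)
  (f : sphere R -> M) (f_Lpk : Lpk_map A k p f)
  (f_nonconstant : ~ exists c : M, f = cst c) :
  [/\ stab G f `<=` G, group_closed [in stab G f] & compact (stab G f)].
Proof.
have [X ->] := reparam_fixing _ _ G_reparam.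
split; first by move=> g [].
  exact: stab_group_closed.
apply: stab_compact => //; last by have [] := f_Lpk.
exact/accessible_closed_set1/hausdorff_accessible.
Qed.
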